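(* Let $\mu^K$ be the probability measure on $\mathbb N_0^{\overline{\mathbb V}}$ defined by $\int\mu^K(d\underline k)\varphi(\underline k)=\int\nu^O(d\underline s)\sum_{\underline k}\varphi(\underline k)\prod_{i\in\overline{\mathbb V}}\left(\frac{s_i}{s_i+1}\right)^{k_i}\frac1{s_i+1}$ for test functions $\varphi$ (a product of geometric random variables with random means $s_i$, where $\underline s$ is distributed according to $\nu^O$). Then $\mu^K$ is invariant for the discrete KMP process with generator $L^K$ and boundary conditions $T_{\partial\mathbb V}$.
   Context: Graph: finite oriented graph $(\overline{\mathbb V},\overline E)$, $\overline{\mathbb V}=\mathbb V\cup\partial\mathbb V$ (internal/boundary vertices), $\overline E=E\cup\partial E$ with $E$ the edges inside $\mathbb V$ and $\partial E$ the edges $ij$ with $i\in\mathbb V$, $j\in\partial\mathbb V$; no edges between boundary vertices; at most one edge per pair. Fixed boundary temperatures $T_j>0$, $j\in\partial\mathbb V$. $\mathbb N_0=\{0,1,\dots\}$. Opinion process: Markov process on $\mathbb R_+^{\overline{\mathbb V}}$ with $O_j\equiv T_j$ for $j\in\partial\mathbb V$ and generator $L^Of(O)=\sum_{ij\in\overline E}\int_0^1dv\,[f(H^O_{ij;v}O)-f(O)]$, $(H^O_{ij;v}O)_\ell=vO_i+(1-v)O_j$ for $\ell\in\{i,j\}\cap\mathbb V$, $=O_\ell$ otherwise. $\nu^O$ denotes its unique invariant probability measure. Discrete KMP process with boundary conditions $T_{\partial\mathbb V}$: Markov process on $\mathbb N_0^{\overline{\mathbb V}}$ with generator $L^Kf(\underline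 k)=\sum_{ij\in\overline E}\frac1{k_i+k_j+1}\sum_{h=0}^{k_i+k_j}\Big(\mathbf 1\{j\in\mathbb V\}[f(H_{ij;h}\underline k)-f(\underline k)]+\mathbf 1\{j\in\partial\mathbb V\}\sum_{b\ge0}\left(\frac{T_j}{T_j+1}\right)^b\frac1{T_j+1}[f(H_{ij;h,b}\underline k)-f(\underline k)]\Big)$, where $(H_{ij;h}\underline k)_i=h$, $(H_{ij;h}\underline k)_j=k_i+k_j-h$, other coordinates unchanged; and $(H_{ij;h,b}\underline k)_j=b$, $(H_{ij;h,b}\underline k)_\ell=(H_{ij;h}\underline k)_\ell$ for $\ell\neq j$. *)

(* Defs.v *)
From HB Require Import structures.
From mathcomp Require Import all_boot all_order all_algebra.
From mathcomp Require Import all_classical all_reals all_analysis.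
Set Implicit Arguments. Unset Strict Implicit. Unset Printing Implicit Defensive.
Import Order.TTheory GRing.Theory Num.Theory.
Import numFieldNormedType.Exports.
Local Open Scope classical_set_scope.
Local Open Scope ring_scope.

(* Graph: vertex set Vbar = finType [Vb]; [bnd] marks the boundary     *)
(* vertices (the others are the internal vertices V).  Oriented edges  *)
(* are pairs (i,j) in a set [E : {set Vb * Vb}].                       *)

Definition graph_ok (Vb : finType) (bnd : pred Vb) (E : {set Vb * Vb}) : Prop :=
  (* every edge ij has i internal (so ij is in E or in dE, never between
     two boundary vertices, boundary edges oriented internal -> boundary) *)
  (forall e, e \in E -> ~~ bnd e.1) /\
  (forall e, e \in E -> e.1 != e.2) /\
  (forall i j, (i, j) \in E -> (j, i) \notin E).

Definition coord_cyl (Vb : finType) (R : realType) : set (set (Vb -> R)) :=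
  \bigcup_(i in [set: Vb])
     preimage_set_system [set: Vb -> R] (fun x : Vb -> R => x i)
       (@measurable _ R).

Definition ostate (Vb : finType) (R : realType) :=
  g_sigma_algebraType (@coord_cyl Vb R).
HB.instance Definition _ (Vb : finType) (R : realType) :=
  Measurable.on (ostate Vb R).

Definition HO (Vb : finType) (R : realType) (bnd : pred Vb)
    (e : Vb * Vb) (v : R) (O : Vb -> R) : Vb -> R :=
  fun l => if ((l == e.1) || (l == e.2)) && ~~ bnd l
           then v * O e.1 + (1 - v) * O e.2 else O l.

Definition LO (Vb : finType) (R : realType) (bnd : pred Vb) (E : {set Vb * Vb})
    (f : (Vb -> R) -> R) (O : Vb -> R) : R :=
  \sum_(e in E)
     Rintegral (@lebesgue_measure R) `[0%R, 1%R]
       (fun v => f (HO bnd e v O) - f O).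

Definition O_supported (Vb : finType) (R : realType) (bnd : pred Vb)
    (T : Vb -> R) (nu : probability (ostate Vb R) R) : Prop :=
  nu [set O : ostate Vb R | forall i, 0 <= O i /\ (bnd i -> O i = T i)] = 1%E.

Definition O_invariant (Vb : finType) (R : realType) (bnd : pred Vb)
    (E : {set Vb * Vb}) (nu : probability (ostate Vb R) R) : Prop :=
  forall f : ostate Vb R -> R,
    measurable_fun [set: ostate Vb R] f ->
    (exists M : R, forall O, `|f O| <= M) ->
    (\int[nu]_O (LO bnd E f O)%:E = 0)%E.

(* Discrete KMP process: state space N_0^Vbar, with the discrete       *)
(* sigma-algebra (used only to sum against the counting measure).      *)

Definition kstate (Vb : finType) := {ffun Vb -> nat}.
HB.instance Definition _ (Vb : finType) := Choice.on (kstate Vb).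
HB.instance Definition _ (Vb : finType) :=
  isPointed.Build (kstate Vb) [ffun=> 0%N].
HB.instance Definition _ (Vb : finType) :=
  @isMeasurable.Build default_measure_display (kstate Vb) discrete_measurable
    discrete_measurable0 discrete_measurableC discrete_measurableU.

Definition HK (Vb : finType) (e : Vb * Vb) (h : nat) (k : kstate Vb) : kstate Vb :=
  [ffun l => if l == e.1 then h
             else if l == e.2 then (k e.1 + k e.2 - h)%N else k l].

Definition HKb (Vb : finType) (e : Vb * Vb) (h b : nat) (k : kstate Vb) : kstate Vb :=
  [ffun l => if l == e.2 then b else HK e h k l].

Definition LK (Vb : finType) (R : realType) (bnd : pred Vb) (E : {set Vb * Vb})
    (T : Vb -> R) (phi : kstate Vb -> R) (k : kstate Vb) : R :=
  \sum_(e in E)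
    ((k e.1 + k e.2 + 1)%:R)^-1 *
    \sum_(0 <= h < (k e.1 + k e.2).+1)
       (if ~~ bnd e.2 then phi (HK e h k) - phi k
        else limn (fun n => \sum_(0 <= b < n)
               ((T e.2 / (T e.2 + 1)) ^+ b * (T e.2 + 1)^-1 *
                (phi (HKb e h b k) - phi k)))).

Definition geom_weight (Vb : finType) (R : realType) (s : Vb -> R) (k : kstate Vb) : R :=
  \prod_(i : Vb) ((s i / (s i + 1)) ^+ (k i) * (s i + 1)^-1).

Definition muK_int (Vb : finType) (R : realType)
    (nu : probability (ostate Vb R) R) (phi : kstate Vb -> R) : \bar R :=
  (\int[nu]_s
     (\int[@counting (kstate Vb) R]_k (phi k * geom_weight s k)%:E))%E.

Definition K_invariant_muK (Vb : finType) (R : realType) (bnd : pred Vb)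
    (E : {set Vb * Vb}) (T : Vb -> R) (nu : probability (ostate Vb R) R) : Prop :=
  forall phi : kstate Vb -> R,
    (exists M : R, forall k, `|phi k| <= M) ->
    muK_int nu (LK bnd E T phi) = 0%E.

(* Main.v *)
Require Import Defs.
From HB Require Import structures.
From mathcomp Require Import all_boot all_order all_algebra.
From mathcomp Require Import all_classical all_reals all_analysis.
From mathcomp Require Import measurable_realfun ring lra.
Set Implicit Arguments.
Unset Strict Implicit.
Unset Printing Implicit Defensive.
Import Order.TTheory GRing.Theory Num.Theory.
Import numFieldNormedType.Exports.
Local Open Scope classical_set_scope.
Local Open Scope ring_scope.

(* For an internal edge, averaging the means s_i, s_j with a uniform weight acts on the
   product of geometric laws exactly as the uniform splitting of k_i + k_j does: with
   y = m / (m + 1) the integral over the weight of y^(k_i + k_j) / (m + 1)^2 is a geometric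
   sum. The splitting is reversible for the counting measure, and a boundary edge only adds
   an independent resampling of k_j, whose mean is already T_j. Hence the mixture
   f(s) = sum_k phi(k) w_s(k) intertwines the generators,
   L^O f(s) = sum_k (L^K phi)(k) w_s(k) on the support of nu^O, and invariance of nu^O
   tested on the bounded function f gives the claim. *)

(** * Geometric laws on the natural numbers *)

(** The geometric law with mean [s], i.e. success probability 1/(s+1); [geom_weight] is a product of
    such factors. *)
Definition geom {R : realType} (s : R) (n : nat) : R :=
  (s / (s + 1)) ^+ n * (s + 1)^-1.

Lemma geom_ge0 (R : realType) (s : R) n : 0 <= s -> 0 <= geom s n.
Proof.
move=> s0; have s1 : 0 <= (s + 1)^-1 by rewrite invr_ge0; lra.
by rewrite /geom mulr_ge0// exprn_ge0// mulr_ge0.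
Qed.

Lemma cvg_geom (R : realType) (s : R) : 0 <= s ->
  (fun n => \sum_(0 <= b < n) geom s b) @ \oo --> (1 : R).
Proof.
move=> s0; have s1 : s + 1 != 0 by apply: lt0r_neq0; lra.
have -> : (1 : R) = (s + 1)^-1 * (1 - s / (s + 1))^-1.
  have -> : 1 - s / (s + 1) = (s + 1)^-1 by field.
  by rewrite invrK mulVf.
have <- : series (geometric (s + 1)^-1 (s / (s + 1))) =
    (fun n => \sum_(0 <= b < n) geom s b).
  by apply/funext => n; apply: eq_bigr => i _; rewrite /geom [RHS]mulrC.
apply: (@cvg_geometric_series R).
rewrite ger0_norm ?divr_ge0//; last lra.
by rewrite ltr_pdivrMr ?mul1r; lra.
Qed.

Lemma nneseries_geom (R : realType) (s : R) : 0 <= s ->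
  (\sum_(b <oo) (geom s b)%:E = 1)%E.
Proof.
move=> s0; apply/cvg_lim => //.
under eq_fun do rewrite sumEFin.
by apply: cvg_EFin; [exact: nearW|exact: cvg_geom].
Qed.

Lemma sum_geom_le1 (R : realType) (s : R) n : 0 <= s ->
  \sum_(0 <= b < n) geom s b <= 1.
Proof.
move=> s0; rewrite -lee_fin -sumEFin -(nneseries_geom s0).
by apply: nneseries_lim_ge => b _; rewrite lee_fin geom_ge0.
Qed.

(** Factorization of x^(N+1) - y^(N+1) at x = a/(a+1), y = b/(b+1), where x - y = (a-b)/((a+1)(b+1))
    supplies the two normalizing factors. Keeping a - b as a factor on the left avoids a division
    when the means coincide. *)
Lemma geom_convolution (R : realType) (a b : R) N : 0 <= a -> 0 <= b ->
  (a - b) * \sum_(0 <= h < N.+1) geom a h * geom b (N - h) =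
  (a / (a + 1)) ^+ N.+1 - (b / (b + 1)) ^+ N.+1.
Proof.
move=> a0 b0; have a1 : a + 1 != 0 by apply: lt0r_neq0; lra.
have b1 : b + 1 != 0 by apply: lt0r_neq0; lra.
rewrite subrXX.
have -> : a / (a + 1) - b / (b + 1) = (a - b) * ((a + 1)^-1 * (b + 1)^-1).
  by field; rewrite a1 b1.
rewrite -mulrA; congr (_ * _); rewrite mulr_sumr big_mkord.
rewrite (reindex_inj rev_ord_inj)/=; apply: eq_bigr => i _.
rewrite /geom subKn; last by rewrite -ltnS.
by rewrite subSS; ring.
Qed.

Lemma continuous_geom (R : realType) n (s : R) : 0 <= s ->
  {for s, continuous (fun x : R => geom x n)}.
Proof.
move=> s0; have s1 : s + 1 != 0 by apply: lt0r_neq0; lra.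
have c1 : {for s, continuous (fun x : R => (x + 1)^-1)}.
  by apply: cvgV => //; apply: cvgD; [exact: cvg_id|exact: cvg_cst].
apply: cvgM => //.
apply: (@continuous_comp _ _ _ (fun x : R => x / (x + 1)) (fun y => y ^+ n)).
  by apply: cvgM => //; exact: cvg_id.
exact: exprn_continuous.
Qed.

(** * Integration over the averaging weight *)

(** With m = v a + (1-v) b, the quotient m/(m+1) has derivative (a-b)/(m+1)^2, and the power rule
    does the rest. This provides the antiderivative for [integral_geomMgeom]. *)
Lemma is_derive_odds (R : realType) (a b v : R) N :
  v * a + (1 - v) * b + 1 != 0 ->
  is_derive v 1
    (fun v => ((v * a + (1 - v) * b) / (v * a + (1 - v) * b + 1)) ^+ N.+1)
    (N.+1%:R * (a - b) *
     (((v * a + (1 - v) * b) / (v * a + (1 - v) * b + 1)) ^+ N *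
      (v * a + (1 - v) * b + 1) ^- 2)).
Proof.
move=> m0.
pose m (v : R) := v * a + (1 - v) * b.
have dm : is_derive v 1 m (a - b).
  have -> : m = cst b + (a - b) \*: id.
    by apply/funext => x; rewrite /m /cst /= !fctE /= /GRing.scale/=; ring.
  apply: is_derive_eq; rewrite add0r /GRing.scale/=; ring.
have dm1 : is_derive v 1 (fun x => m x + 1) (a - b).
  have -> : (fun x => m x + 1) = m + cst 1 by [].
  by apply: is_derive_eq; rewrite addr0.
have dV : is_derive v 1 (fun x => (m x + 1)^-1) (- (m v + 1) ^- 2 * (a - b)).
  apply: DeriveDef; first by apply: derivableV.
  by rewrite deriveV// derive_val.
have dq : is_derive v 1 (m * (fun x => (m x + 1)^-1))
    ((a - b) * (m v + 1) ^- 2).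
  apply: is_derive_eq; rewrite /GRing.scale/=.
  by field.
have -> : (fun v => ((v * a + (1 - v) * b) / (v * a + (1 - v) * b + 1)) ^+ N.+1)
   = (m * (fun x => (m x + 1)^-1)) ^+ N.+1.
  by apply/funext => x; rewrite exprfctE.
apply: is_derive_eq; rewrite /GRing.scale/= -/(m v).
by rewrite !mulrA; ring.
Qed.

(** At equal means only the total p + q matters: this is why averaging two means corresponds to a
    uniform splitting of the total. *)
Lemma geomMgeom (R : realType) (s : R) p q :
  geom s p * geom s q = (s / (s + 1)) ^+ (p + q) * (s + 1) ^- 2.
Proof. by rewrite /geom exprD expr2 invfM; ring. Qed.

Lemma mix_ge0 (R : realType) (a b v : R) :
  0 <= a -> 0 <= b -> v \in `[0, 1] -> 0 <= v * a + (1 - v) * b.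
Proof.
by move=> a0 b0; rewrite in_itv/= => /andP[v0 v1]; rewrite addr_ge0 ?mulr_ge0 ?subr_ge0.
Qed.

(* Substituting y = m / (m + 1) with m = v a + (1 - v) b, so that dy = dm / (m + 1)^2,
   turns the left-hand side into the integral of y^(p + q). *)
Lemma integral_geomMgeom (R : realType) (a b : R) p q : 0 <= a -> 0 <= b ->
  (\int[@lebesgue_measure R]_(v in `[0%R, 1%R])
    (geom (v * a + (1 - v) * b) p * geom (v * a + (1 - v) * b) q)%:E)%E =
  ((p + q + 1)%:R^-1 *
    \sum_(0 <= h < (p + q).+1) geom a h * geom b (p + q - h))%:E.
Proof.
move=> a0 b0.
have Nn0 : (p + q).+1%:R != 0 :> R by rewrite pnatr_eq0.
(* For equal means the antiderivative below would divide by a - b = 0; there the integrand is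
   constant, and so are the p + q + 1 summands. *)
have [<-|ab] := eqVneq a b.
  under eq_integral => v _.
    rewrite (_ : v * a + (1 - v) * a = a); last by ring.
    over.
  rewrite integral_cst//= lebesgue_measure_itv/= lte_fin ltr01 oppr0 adde0 mule1.
  congr EFin; rewrite big_mkord (eq_bigr (fun=> geom a p * geom a q)).
    by rewrite sumr_const card_ord addn1 -[(_ * _) *+ _]mulr_natl mulKf.
  by move=> i _; rewrite !geomMgeom subnKC// -ltnS.
have ab0 : a - b != 0 by rewrite subr_eq0.
set N := (p + q)%N in Nn0 *.
(* [c] cancels the factor that differentiating the power N + 1 of m/(m+1) produces. *)
pose c := (N.+1%:R * (a - b))^-1.
pose m (v : R) := v * a + (1 - v) * b.
pose G (v : R) := (m v / (m v + 1)) ^+ N.+1.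
have m0 (v : R) : v \in `[0, 1] -> 0 <= m v by exact: mix_ge0.
have dF (v : R) : v \in `[0, 1] -> is_derive v 1 (c \*: G)
    ((m v / (m v + 1)) ^+ N * (m v + 1) ^- 2).
  move=> v01.
  have := @is_derive_odds R a b v N; rewrite -/(m v).
  have -> : m v + 1 != 0 by apply: lt0r_neq0; have := m0 v v01; lra.
  move=> /(_ erefl) dG; apply: is_derive_eq.
  rewrite /GRing.scale/= [LHS]mulrA [X in X * _]mulVf ?mul1r//.
  by rewrite mulf_neq0.
have cF (v : R) : v \in `[0, 1] -> {for v, continuous (c \*: G)}.
  by move=> /dF [d _]; exact/differentiable_continuous/derivable1_diffP.
rewrite (@continuous_FTC2 _ _ (c \*: G)) ?ltr01//.
(* The mean is [a] at v = 1 and [b] at v = 0, so the boundary terms are the right-hand side of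
   [geom_convolution]. *)
- rewrite -EFinB; congr EFin; rewrite /= /G /m.
  rewrite !(mul0r, mul1r, subr0, subrr, addr0, add0r) /GRing.scale/=.
  rewrite -mulrBr -geom_convolution// addn1 /c invfM -!mulrA. rewrite (mulKf ab0).
  by congr (_ * _); apply: eq_bigr.
- apply: continuous_in_subspaceT => v /set_mem/= v01.
  have cm : {for v, continuous m}.
    by apply: cvgD; apply: cvgM; rewrite //; try exact: cvg_cst;
      apply: cvgB; [exact: cvg_cst|exact: cvg_id].
  have cg n : {for v, continuous (fun v => geom (m v) n)}.
    apply: (@continuous_comp _ _ _ m (fun s => geom s n)) => //.
    exact/continuous_geom/m0.
  by apply: cvgM; exact: cg.
- split.
  + move=> v v01; have /dF[] // : v \in `[0, 1] by apply: subset_itv_oo_cc.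
  + by apply: cvg_at_right_filter; apply: cF; rewrite in_itv/= lexx ler01.
  + by apply: cvg_at_left_filter; apply: cF; rewrite in_itv/= lexx ler01.
- move=> v v01; have /dF[? dv] : v \in `[0, 1] by apply: subset_itv_oo_cc.
  by rewrite derive1E dv geomMgeom.
Qed.

(** * Comparison of integrals off a null set *)

Import HBNNSimple.

(** A simple function below [f], set to 0 off [S], lies below [g] everywhere and keeps its integral
    because the complement of [S] is null. *)
Lemma ge0_le_integral_full d (T : measurableType d) (R : realType)
    (mu : {measure set T -> \bar R}) (S : set T) (f g : T -> \bar R) :
  measurable S -> mu (~` S) = 0%E ->
  (forall x, 0 <= f x)%E -> (forall x, 0 <= g x)%E ->
  (forall x, S x -> f x <= g x)%E ->
  (\int[mu]_x f x <= \int[mu]_x g x)%E.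
Proof.
move=> mS S0 f0 g0 fg; rewrite !ge0_integralTE//.
apply: ge_ereal_sup => _ [h /= hf <-]; apply: ereal_sup_ubound => /=.
have pE x : proj_nnsfun h mS x = if x \in S then h x else 0.
  by rewrite -mrestrict patchE.
exists (proj_nnsfun h mS); first move=> x.
  rewrite pE; case: ifPn => // xS.
  by rewrite (le_trans (hf x))// fg//; exact: set_mem.
have sE (k : {nnsfun T >-> R}) : sintegral mu k = (\int[mu]_x (k x)%:E)%E.
  by rewrite integral_nnsfun// patch_setT.
have hN : (\int[mu]_x (h x)%:E = \int[mu]_(x in setT `\` ~` S) (h x)%:E)%E.
  apply: ge0_negligible_integral => //; first exact: measurableC.
    by apply/measurable_EFinP.
  by move=> x _; rewrite lee_fin.
rewrite !sE hN.
rewrite setTD setCK [RHS]integral_mkcond; apply: eq_integral => x _.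
by rewrite pE patchE; case: ifP.
Qed.

(* No measurability is assumed: the integral is a supremum over simple functions,
   which may be cut off to [S]. *)
Lemma eq_integral_full d (T : measurableType d) (R : realType)
    (mu : {measure set T -> \bar R}) (S : set T) (f g : T -> \bar R) :
  measurable S -> mu (~` S) = 0%E -> (forall x, S x -> f x = g x) ->
  (\int[mu]_x f x = \int[mu]_x g x)%E.
Proof.
move=> mS S0 fg; rewrite integralE [RHS]integralE.
have pE x : S x -> (f^\+ x = g^\+ x)%E by rewrite !funeposE => /fg ->.
have nE x : S x -> (f^\- x = g^\- x)%E by rewrite !funenegE => /fg ->.
congr (_ - _)%E; apply/eqP; rewrite eq_le; apply/andP; split;
  by apply: (ge0_le_integral_full mS S0) => // x Sx; rewrite ?pE ?nE.
Qed.

(** * Sums over countable types *)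

(** Enumeration along [pickle], with value 0 at integers that code no element. It transfers results
    on series over the integers to any countable type, in particular to configurations. *)
Lemma esum_oapp_pickle (R : realType) (T : countType) (a : T -> \bar R) :
  (forall x, 0 <= a x)%E ->
  (\esum_(x in [set: T]) a x = \sum_(n <oo) oapp a 0 (pickle_inv n))%E.
Proof.
move=> a0; rewrite nneseries_esumT; last by move=> n; case: pickle_inv => /=.
transitivity (\esum_(n in range (@pickle T)) oapp a 0%E (pickle_inv n)).
  rewrite esum_image; last by move=> x y _ _ /(pcan_inj pickleK).
  by apply: eq_esum => x _; rewrite pickleK_inv.
rewrite esum_mkcond; apply: eq_esum => n _; case: ifP => // /negP nr.
case E : (pickle_inv n) => [x|//] /=; exfalso; apply: nr.
by apply/mem_set; exists x => //; have := @pickle_invK T n; rewrite E.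
Qed.

Lemma integral_esum d (X : measurableType d) (R : realType)
    (mu : {measure set X -> \bar R}) (D : set X) (T : countType)
    (f : T -> X -> \bar R) :
  measurable D -> (forall t, measurable_fun D (f t)) ->
  (forall t x, D x -> 0 <= f t x)%E ->
  (\int[mu]_(x in D) (\esum_(t in [set: T]) f t x))%E =
  \esum_(t in [set: T]) (\int[mu]_(x in D) f t x)%E.
Proof.
move=> mD mf f0; under eq_integral => x /set_mem Dx.
  rewrite esum_oapp_pickle; last by move=> t; exact: f0.
  over.
rewrite integral_nneseries//.
- rewrite esum_oapp_pickle; last first.
    by move=> t; apply: integral_ge0 => x; exact: f0.
  apply: eq_eseriesr => n _; case: pickle_inv => [t|]//=.
  by rewrite integral0.
- by move=> n; case: pickle_inv => [t|] /=; [exact: mf|exact: measurable_cst].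
- by move=> n x Dx; case: pickle_inv => [t|] //=; exact: f0.
Qed.

Lemma measurable_esum d (X : measurableType d) (R : realType) (T : countType)
    (D : set X) (f : T -> X -> \bar R) :
  (forall t, measurable_fun D (f t)) -> (forall t x, D x -> 0 <= f t x)%E ->
  measurable_fun D (fun x => \esum_(t in [set: T]) f t x).
Proof.
move=> mf f0.
apply: (@eq_measurable_fun _ _ _ _ _ (fun x =>
    \sum_(n <oo) oapp (fun t => f t x) 0 (pickle_inv n))%E).
  by move=> x /set_mem Dx; rewrite esum_oapp_pickle// => t; exact: f0.
apply: ge0_emeasurable_sum.
- by move=> n x Dx _; case: pickle_inv => [t|] //=; exact: f0.
- by move=> n _; case: pickle_inv => [t|] /=; [exact: mf|exact: measurable_cst].
Qed.

Lemma esumZl (R : realType) (T : countType) (c : R) (a : T -> \bar R) :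
  0 <= c -> (forall n, 0 <= a n)%E ->
  (\esum_(n in setT) (c%:E * a n) = c%:E * \esum_(n in setT) a n)%E.
Proof.
move=> c0 a0; rewrite !esum_oapp_pickle//; last by move=> n; rewrite mule_ge0.
rewrite -nneseriesZl; last by move=> n _; case: pickle_inv.
by apply: eq_eseriesr => n _; case: pickle_inv => //=; rewrite mule0.
Qed.

Lemma esum_pred1 (R : realType) (T : choiceType) (t : T) (a : T -> \bar R) :
  (0 <= a t)%E ->
  \esum_(x in [set: T]) (if x == t then a x else 0%E) = a t.
Proof.
move=> a0; rewrite -[RHS]esum_set1// [RHS]esum_mkcond; apply: eq_esum => x _.
by rewrite classical_sets.in_set1.
Qed.

HB.instance Definition _ (Vb : finType) := Countable.on (kstate Vb).

(** [f] is the sum of its restrictions to single points; after exchanging sum and integral, each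
    singleton has counting measure 1. *)
Lemma integral_counting_esum (R : realType) (Vb : finType)
    (f : kstate Vb -> \bar R) :
  (forall k, 0 <= f k)%E ->
  (\int[@counting (kstate Vb) R]_k f k = \esum_(k in setT) f k)%E.
Proof.
move=> f0.
transitivity (\int[@counting (kstate Vb) R]_k
    (\esum_(l in [set: kstate Vb]) (if l == k then f l else 0)))%E.
  by apply: eq_integral => k _; rewrite esum_pred1.
rewrite integral_esum//; last by move=> l k _; case: ifP.
apply: eq_esum => l _.
transitivity (\int[@counting (kstate Vb) R]_(k in [set l]) cst (f l) k)%E.
  rewrite [RHS]integral_mkcond; apply: eq_integral => k _.
  by rewrite patchE classical_sets.in_set1 eq_sym.
have c1 : @counting (kstate Vb) R [set l] = 1%E.
  by rewrite /counting asboolT// fset_set1 finmap.cardfs1.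
by rewrite integral_cst// [X in (_ * X)%E]c1 mule1.
Qed.

Lemma EFin_sum_esum (R : realType) (a : nat -> R) n :
  (forall i, 0 <= a i) ->
  (\sum_(0 <= i < n) a i)%:E = \esum_(i in `I_n) (a i)%:E.
Proof.
move=> a0; rewrite esum_fset//; last by move=> i _; rewrite lee_fin.
by rewrite -fsbig_ord -sumEFin big_mkord.
Qed.

(** * Reversibility of the uniform splitting *)

(** The Markov kernel of one uniform redistribution across [e]; on an internal edge the generator is
    this kernel minus the identity. *)
Definition split_avg (Vb : finType) (R : realType) (e : Vb * Vb)
    (psi : kstate Vb -> R) (k : kstate Vb) : R :=
  (k e.1 + k e.2 + 1)%:R^-1 *
    \sum_(0 <= h < (k e.1 + k e.2).+1) psi (HK e h k).

Lemma split_avg_ge0 (Vb : finType) (R : realType) (e : Vb * Vb)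
    (psi : kstate Vb -> R) k :
  (forall k, 0 <= psi k) -> 0 <= split_avg e psi k.
Proof. by move=> psi0; rewrite mulr_ge0 ?invr_ge0// sumr_ge0. Qed.

Lemma HK1 (Vb : finType) (e : Vb * Vb) h (k : kstate Vb) : HK e h k e.1 = h.
Proof. by rewrite ffunE eqxx. Qed.

Lemma HK2 (Vb : finType) (e : Vb * Vb) h (k : kstate Vb) : e.1 != e.2 ->
  HK e h k e.2 = (k e.1 + k e.2 - h)%N.
Proof. by move=> e12; rewrite ffunE eq_sym (negPf e12) eqxx. Qed.

Lemma HK_total (Vb : finType) (e : Vb * Vb) h (k : kstate Vb) :
  e.1 != e.2 -> (h <= k e.1 + k e.2)%N ->
  (HK e h k e.1 + HK e h k e.2 = k e.1 + k e.2)%N.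
Proof. by move=> e12 hk; rewrite HK1 HK2// subnKC. Qed.

Lemma HKK (Vb : finType) (e : Vb * Vb) h (k : kstate Vb) :
  e.1 != e.2 -> (h <= k e.1 + k e.2)%N -> HK e (k e.1) (HK e h k) = k.
Proof.
move=> e12 hk; apply/ffunP => l; rewrite ffunE HK_total//.
have [->//|l1] := eqVneq l e.1; have [->|l2] := eqVneq l e.2.
  by rewrite addKn.
by rewrite ffunE (negPf l1) (negPf l2).
Qed.

(* Reversibility: (k, h) |-> (HK e h k, k e.1) is an involution of the pairs with
   h <= k e.1 + k e.2, and it preserves the total k e.1 + k e.2. *)
Lemma esum_split_avg (Vb : finType) (R : realType) (e : Vb * Vb)
    (psi w : kstate Vb -> R) :
  e.1 != e.2 -> (forall k, 0 <= psi k) -> (forall k, 0 <= w k) ->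
  \esum_(k in setT) (split_avg e psi k * w k)%:E =
  \esum_(k in setT) (psi k * split_avg e w k)%:E.
Proof.
move=> e12 psi0 w0.
pose J (k : kstate Vb) := `I_(k e.1 + k e.2).+1.
pose F (f g : kstate Vb -> R) (z : kstate Vb * nat) :=
  ((z.1 e.1 + z.1 e.2 + 1)%:R^-1 * f (HK e z.2 z.1) * g z.1)%:E.
have FE f g : (forall k, 0 <= f k) -> (forall k, 0 <= g k) ->
    \esum_(k in setT) (split_avg e f k * g k)%:E =
    \esum_(z in setT `*`` J) F f g z.
  move=> f0 g0; rewrite -(@esum_esum _ _ _ setT J (fun k h => F f g (k, h))).
    apply: eq_esum => k _; rewrite /split_avg mulr_sumr mulr_suml EFin_sum_esum//.
    by move=> h; rewrite !mulr_ge0 ?invr_ge0.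
  by move=> k h _ _; rewrite lee_fin !mulr_ge0 ?invr_ge0.
(* Both sides become sums over the same pairs (k, h), with [psi] and [w] exchanged. *)
under [RHS]eq_esum do rewrite mulrC.
rewrite !FE//.
pose S (z : kstate Vb * nat) := (HK e z.2 z.1, z.1 e.1).
have JE k h : J k h = (h <= k e.1 + k e.2)%N by rewrite /J /= ltnS.
have SK z : (setT `*`` J) z -> S (S z) = z.
  case: z => k h [_]; rewrite JE => hk.
  by rewrite /S /= HKK// HK1.
have SJ z : (setT `*`` J) z -> (setT `*`` J) (S z).
  case: z => k h [_]; rewrite JE => hk; split=> //.
  by rewrite JE /= HK_total// leq_addr.
rewrite (reindex_esum (setT `*`` J) _ S)//; last first.
  split => //.
  - by move=> x y /set_mem xJ /set_mem yJ xy; rewrite -(SK x)// xy SK.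
  - by move=> x xJ; exists (S x); [exact: SJ|exact: SK].
apply: eq_esum => -[k h] [_]; rewrite JE => hk.
by rewrite /F /S /= HK_total// HKK// mulrAC.
Qed.

(** * Resampling of one coordinate *)

Definition upd (A : eqType) (B : Type) (j : A) (b : B) (f : A -> B) : A -> B :=
  fun l => if l == j then b else f l.

Definition kupd (Vb : finType) (j : Vb) (b : nat) (k : kstate Vb) : kstate Vb :=
  [ffun l => upd j b k l].

Lemma kupdK (Vb : finType) (j : Vb) b (k : kstate Vb) :
  kupd j (k j) (kupd j b k) = k.
Proof.
apply/ffunP => l; rewrite ffunE /upd; have [->//|lj] := eqVneq l j.
by rewrite ffunE /upd (negPf lj).
Qed.

Lemma kupdE (Vb : finType) (j : Vb) b (k : kstate Vb) : kupd j b k j = b.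
Proof. by rewrite ffunE /upd eqxx. Qed.

Lemma geom_weight_ge0 (Vb : finType) (R : realType) (s : Vb -> R) (k : kstate Vb) :
  (forall i, 0 <= s i) -> 0 <= geom_weight s k.
Proof. by move=> s0; apply: prodr_ge0 => i _; exact: geom_ge0. Qed.

(** Both sides are [geom t (k j)] times [geom (s j) b] times the unchanged factors of the other
    vertices. This is the detailed balance behind [esum_resample]. *)
Lemma geom_weight_upd (Vb : finType) (R : realType) (s : Vb -> R) j t b
    (k : kstate Vb) :
  geom t (k j) * geom_weight s (kupd j b k) =
  geom (s j) b * geom_weight (upd j t s) k.
Proof.
rewrite /geom_weight (bigD1 j)//= [in RHS](bigD1 j)//= kupdE /upd eqxx.
rewrite mulrCA; congr (_ * (_ * _)); apply: eq_bigr => i ij.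
by rewrite ffunE /upd (negPf ij).
Qed.

(** The expectation of [psi] once coordinate [j] is replaced by a geometric variable of mean [t];
    the limit of partial sums is the form found in [LK]. *)
Definition resample (Vb : finType) (R : realType) (j : Vb) (t : R)
    (psi : kstate Vb -> R) (k : kstate Vb) : R :=
  limn (fun n => \sum_(0 <= b < n) geom t b * psi (kupd j b k)).

Section resample.
Variables (Vb : finType) (R : realType) (j : Vb) (t : R) (psi : kstate Vb -> R).
Variable M : R.
Hypotheses (t0 : 0 <= t) (psi0 : forall k, 0 <= psi k).
Hypothesis psiM : forall k, psi k <= M.

Let term_ge0 k b : 0 <= geom t b * psi (kupd j b k).
Proof. by rewrite mulr_ge0// geom_ge0. Qed.

Let psum_le k n : \sum_(0 <= b < n) geom t b * psi (kupd j b k) <= M.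
Proof.
have M0 : 0 <= M by apply: le_trans (psi0 k) (psiM k).
apply: (@le_trans _ _ (\sum_(0 <= b < n) geom t b * M)).
  by apply: ler_sum => b _; rewrite ler_wpM2l// geom_ge0.
by rewrite -mulr_suml ler_piMl// sum_geom_le1.
Qed.

Lemma is_cvg_resample k :
  cvgn (fun n => \sum_(0 <= b < n) geom t b * psi (kupd j b k)).
Proof.
apply: nondecreasing_is_cvgn; last by exists M => _ [n _ <-].
exact: (@nondecreasing_series R (fun b => geom t b * psi (kupd j b k)) predT).
Qed.

Lemma resample_ge0 k : 0 <= resample j t psi k.
Proof.
by apply: limr_ge; [exact: is_cvg_resample|apply: nearW => n; exact: sumr_ge0].
Qed.

(** Passing from the real limit to an unordered sum makes the reindexing of [esum_resample]
    possible. *)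
Lemma EFin_resample k :
  (resample j t psi k)%:E =
  \esum_(b in setT) (geom t b * psi (kupd j b k))%:E.
Proof.
rewrite -nneseries_esumT; last by move=> b; rewrite lee_fin.
apply/esym/cvg_lim => //; under eq_fun do rewrite sumEFin.
by apply: cvg_EFin; [exact: nearW|exact: is_cvg_resample].
Qed.

(* (k, b) |-> (kupd j b k, k j) is an involution. *)
Lemma esum_resample (s : Vb -> R) : (forall i, 0 <= s i) ->
  \esum_(k in setT) (resample j t psi k * geom_weight s k)%:E =
  \esum_(k in setT) (psi k * geom_weight (upd j t s) k)%:E.
Proof.
move=> s0.
pose G (z : kstate Vb * nat) :=
  (geom t z.2 * psi (kupd j z.2 z.1) * geom_weight s z.1)%:E.
pose H (z : kstate Vb * nat) :=
  (psi z.1 * geom_weight (upd j t s) z.1 * geom (s j) z.2)%:E.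
have s0' i : 0 <= upd j t s i by rewrite /upd; case: eqP.
transitivity (\esum_(z in [set: kstate Vb] `*`` (fun=> setT)) G z).
  rewrite -(@esum_esum _ _ _ setT (fun=> setT) (fun k b => G (k, b))).
    apply: eq_esum => k _; rewrite EFinM muleC EFin_resample -esumZl.
    - by apply: eq_esum => b _; rewrite /G /= -EFinM mulrC.
    - exact: geom_weight_ge0.
    - by move=> b; rewrite lee_fin.
  by move=> k b _ _; rewrite lee_fin mulr_ge0// geom_weight_ge0.
(* The old value of coordinate [j] enters [H] as an extra variable with law [geom (s j)]; it sums
   out with mass 1. *)
transitivity (\esum_(z in [set: kstate Vb] `*`` (fun=> setT)) H z); last first.
  rewrite -(@esum_esum _ _ _ setT (fun=> setT) (fun k b => H (k, b))).
    apply: eq_esum => k _ /=; under eq_esum do rewrite /H /= EFinM.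
    rewrite esumZl -?nneseries_esumT ?nneseries_geom ?mule1//.
    - by move=> b; rewrite lee_fin geom_ge0.
    - by rewrite mulr_ge0// geom_weight_ge0.
    - by move=> b; rewrite lee_fin geom_ge0.
  move=> k b _ _; rewrite lee_fin mulr_ge0 ?geom_ge0// mulr_ge0//.
  exact: geom_weight_ge0.
pose S (z : kstate Vb * nat) := (kupd j z.2 z.1, z.1 j).
have SK z : S (S z) = z by case: z => k b; rewrite /S /= kupdK kupdE.
rewrite [RHS](reindex_esum ([set: kstate Vb] `*`` (fun=> setT)) _ S)//; last first.
  split => //; first by move=> x y _ _ xy; rewrite -(SK x) xy SK.
  by move=> x _; exists (S x).
apply: eq_esum => -[k b] _; rewrite /G /H /S /=; congr EFin.
(* The exchange identity is used from the updated means back to [s], so restoring [s j] must give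
   [s] itself. *)
have su : upd j (s j) (upd j t s) = s.
  by apply/funext => l; rewrite /upd; case: eqVneq => [->|].
have := geom_weight_upd (upd j t s) j (s j) b k.
rewrite su {2}/upd eqxx => wE.
by rewrite [RHS]mulrAC -[RHS]mulrA wE; ring.
Qed.

End resample.

(** * Total mass of the product of geometric laws *)

Lemma geom0 (R : realType) n : geom 0 n = (n == 0%N)%:R :> R.
Proof. by rewrite /geom mul0r add0r invr1 mulr1 expr0n. Qed.

Lemma resample_cst1 (Vb : finType) (R : realType) (j : Vb) (t : R) k : 0 <= t ->
  resample j t (cst 1) k = 1.
Proof.
move=> t0; rewrite /resample; apply/cvg_lim => //.
by under eq_fun do under eq_bigr do rewrite mulr1; exact: cvg_geom.
Qed.

(* Resampling the coordinates one after the other with mean 0 preserves the mass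
   and ends at the Dirac mass at 0. *)
Lemma esum_geom_weight (Vb : finType) (R : realType) (s : Vb -> R) :
  (forall i, 0 <= s i) -> \esum_(k in setT) (geom_weight s k)%:E = 1%E.
Proof.
move=> s0.
have sr (r : seq Vb) : \esum_(k in setT) (geom_weight s k)%:E =
    \esum_(k in setT) (geom_weight (fun l => if l \in r then 0 else s l) k)%:E.
  elim: r => [|j r ->]; first by apply: eq_esum.
  have -> : (fun l => if l \in j :: r then 0 else s l) =
      upd j 0 (fun l => if l \in r then 0 else s l).
    by apply/funext => l; rewrite /upd inE; case: eqVneq.
  set s' := fun l => if l \in r then 0 else s l.
  transitivity (\esum_(k in setT) (resample j 0 (cst 1) k * geom_weight s' k)%:E).
    by apply: eq_esum => k _; rewrite resample_cst1// mul1r.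
  rewrite (@esum_resample Vb R j 0 (cst 1) 1)//.
    by apply: eq_esum => k _; rewrite mul1r.
  by rewrite /s' => i; case: ifP.
have := @esum_pred1 R (kstate Vb) [ffun=> 0%N] (fun=> 1%E) lee01.
rewrite (sr (enum Vb)) => <-.
apply: eq_esum => k _; case: eqVneq => [->|k0].
  rewrite /geom_weight big1// => i _.
  by rewrite mem_enum -/(geom _ _) geom0 ffunE.
have [i ki] : exists i, k i != 0%N.
  apply: contrapT => /forallNP ki; move/eqP : k0; apply; apply/ffunP => i.
  by rewrite ffunE; apply/eqP; have /negP := ki i; rewrite negbK.
rewrite /geom_weight (bigD1 i)//= mem_enum -/(geom _ _) geom0.
by rewrite (negPf ki) mul0r.
Qed.

(** * Measurability in the means and in the averaging weight *)

(** The truncation at 0 keeps away from the pole at -1, so continuity, and with it measurability,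
    holds on the whole line. *)
Lemma continuous_geom_max (R : realType) n :
  continuous (fun x : R => geom (Num.max x 0) n).
Proof.
move=> x; apply: (@continuous_comp _ _ _ (fun x : R => Num.max x 0) (fun y : R => geom y n)).
  by apply: continuous_max; [exact: cvg_id|exact: cvg_cst].
by apply: continuous_geom; rewrite le_max lexx orbT.
Qed.

Lemma measurable_geom_max d (X : measurableType d) (R : realType) (D : set X)
    (f : X -> R) n : measurable_fun D f ->
  measurable_fun D (fun x => geom (Num.max (f x) 0) n).
Proof.
move=> mf; apply: (measurableT_comp (f := fun y : R => geom (Num.max y 0) n)) => //.
exact: (continuous_measurable_fun (@continuous_geom_max R n)).
Qed.

Lemma HO_ge0 (Vb : finType) (R : realType) (bnd : pred Vb) (e : Vb * Vb) (v : R)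
    (s : Vb -> R) :
  (forall i, 0 <= s i) -> v \in `[0, 1] -> forall i, 0 <= HO bnd e v s i.
Proof. by move=> s0 v01 i; rewrite /HO; case: ifP => // _; exact: mix_ge0. Qed.

Lemma measurable_geom_mix (R : realType) (a b : R) n : 0 <= a -> 0 <= b ->
  measurable_fun (`[0, 1]%classic : set R) (fun v => geom (v * a + (1 - v) * b) n).
Proof.
move=> a0 b0.
(* For weights in [0, 1] the mixed mean is nonnegative and the truncation changes nothing. *)
apply: (@eq_measurable_fun _ _ _ _ _
    (fun v : R => geom (Num.max (v * a + (1 - v) * b) 0) n)).
  by move=> v /set_mem v01; rewrite max_l// mix_ge0.
apply: measurable_geom_max.
by apply: measurable_funD; apply: measurable_funM => //; apply: measurable_funB.
Qed.

Lemma measurable_geom_weight_HO (Vb : finType) (R : realType)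
    (bnd : pred Vb) (e : Vb * Vb) (s : Vb -> R) (k : kstate Vb) :
  (forall i, 0 <= s i) ->
  measurable_fun (`[0, 1]%classic : set R) (fun v => geom_weight (HO bnd e v s) k).
Proof.
move=> s0; apply: measurable_prod => i _; rewrite -/(geom _ _) /HO.
case: (_ && _); last exact: measurable_cst.
exact: measurable_geom_mix.
Qed.

(** * Duality between splitting and averaging on one edge *)

Lemma geom_weight2 (Vb : finType) (R : realType) (e : Vb * Vb) (s : Vb -> R)
    (k : kstate Vb) : e.1 != e.2 ->
  geom_weight s k = geom (s e.1) (k e.1) * geom (s e.2) (k e.2) *
    \prod_(i | (i != e.1) && (i != e.2)) geom (s i) (k i).
Proof.
move=> e12; rewrite /geom_weight (bigD1 e.1)//= (bigD1 e.2)/= ?mulrA//.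
by rewrite eq_sym.
Qed.

(** Only the two factors at the ends of [e] depend on [v]; the others leave the integral and
    [integral_geomMgeom] remains. With [xpred0] both ends take the mixed mean, as if internal;
    boundary ends are corrected later by resampling. *)
Lemma split_avg_geom_weight (Vb : finType) (R : realType) (e : Vb * Vb)
    (s : Vb -> R) k : e.1 != e.2 -> (forall i, 0 <= s i) ->
  (split_avg e (geom_weight s) k)%:E =
  (\int[@lebesgue_measure R]_(v in `[0%R, 1%R]) (geom_weight (HO xpred0 e v s) k)%:E)%E.
Proof.
move=> e12 s0.
pose r := \prod_(i | (i != e.1) && (i != e.2)) geom (s i) (k i).
have r0 : 0 <= r by apply: prodr_ge0 => i _; exact: geom_ge0.
pose m v := v * s e.1 + (1 - v) * s e.2.
transitivity (\int[@lebesgue_measure R]_(v in `[0%R, 1%R])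
    ((geom (m v) (k e.1) * geom (m v) (k e.2))%:E * r%:E))%E; last first.
  apply: eq_integral => v _; rewrite -EFinM (geom_weight2 _ _ e12).
  rewrite /HO !eqxx orbT /=; congr (_ * _)%:E; apply: eq_bigr => i /andP[i1 i2].
  by rewrite (negPf i1) (negPf i2).
rewrite ge0_integralZr//.
- rewrite integral_geomMgeom// -EFinM -mulrA; congr (_ * _)%:E.
  rewrite mulr_suml; apply: eq_big_nat => h _; rewrite (geom_weight2 _ _ e12).
  rewrite HK1 HK2//; congr (_ * _); apply: eq_bigr => i /andP[i1 i2].
  by rewrite ffunE (negPf i1) (negPf i2).
- by apply/measurable_EFinP; apply: measurable_funM; exact: measurable_geom_mix.
- move=> v v01; rewrite lee_fin; have m0 : 0 <= m v by exact: mix_ge0.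
  by rewrite mulr_ge0// geom_ge0.
Qed.

(** Reversibility moves the splitting from [psi] to the weight, where it becomes an integral over
    [v]; Tonelli then exchanges sum and integral. *)
Lemma esum_split_avg_HO (Vb : finType) (R : realType) (e : Vb * Vb)
    (psi : kstate Vb -> R) (s : Vb -> R) :
  e.1 != e.2 -> (forall k, 0 <= psi k) -> (forall i, 0 <= s i) ->
  \esum_(k in setT) (split_avg e psi k * geom_weight s k)%:E =
  (\int[@lebesgue_measure R]_(v in `[0%R, 1%R])
    (\esum_(k in setT) (psi k * geom_weight (HO xpred0 e v s) k)%:E))%E.
Proof.
move=> e12 psi0 s0; rewrite esum_split_avg//; last by move=> k; exact: geom_weight_ge0.
rewrite integral_esum//.
- apply: eq_esum => k _; rewrite EFinM split_avg_geom_weight//.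
  rewrite -ge0_integralZl//.
  + by apply/measurable_EFinP; exact: measurable_geom_weight_HO.
  + by move=> v v01; rewrite lee_fin geom_weight_ge0//; exact: HO_ge0.
  + by rewrite lee_fin.
- move=> k; apply/measurable_EFinP; apply: measurable_funM => //.
  exact: measurable_geom_weight_HO.
- by move=> k v v01; rewrite lee_fin mulr_ge0// geom_weight_ge0//; exact: HO_ge0.
Qed.

(** * The mixture and the kernel of one edge *)

Definition mixture (Vb : finType) (R : realType) (phi : kstate Vb -> R)
    (s : Vb -> R) : \bar R :=
  \esum_(k in setT) (phi k * geom_weight s k)%:E.

(** On a boundary edge the resampling sits inside the splitting because [HKb] overwrites [e.2] after
    the split. *)
Definition edge_kernel (Vb : finType) (R : realType) (bnd : pred Vb) (T : Vb -> R)
    (phi : kstate Vb -> R) (e : Vb * Vb) : kstate Vb -> R :=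
  split_avg e (if ~~ bnd e.2 then phi else resample e.2 (T e.2) phi).

Lemma HKb_kupd (Vb : finType) (e : Vb * Vb) h b (k : kstate Vb) :
  HKb e h b k = kupd e.2 b (HK e h k).
Proof. by apply/ffunP => l; rewrite !ffunE /upd. Qed.

Lemma measurable_coord (Vb : finType) (R : realType) (i : Vb) :
  measurable_fun setT (fun s : ostate Vb R => s i).
Proof.
move=> _ A mA; apply: sub_gen_smallest; exists i => //.
by exists A.
Qed.

Lemma measurable_support (Vb : finType) (R : realType) (bnd : pred Vb)
    (T : Vb -> R) :
  measurable [set s : ostate Vb R | forall i, 0 <= s i /\ (bnd i -> s i = T i)].
Proof.
rewrite [X in measurable X](_ : _ = \bigcap_(i in [set: Vb])
    [set s : ostate Vb R | 0 <= s i /\ (bnd i -> s i = T i)]); last first.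
  by apply/seteqP; split => [s h i _|s h i]; exact: h.
apply: fin_bigcap_measurable; first exact: finite_finset.
move=> i _.
rewrite [X in measurable X](_ : _ = setT `&` (fun s : ostate Vb R => s i) @^-1`
    (`[0, +oo[%classic `&` (if bnd i then [set T i] else setT))).
  apply: measurable_coord => //; apply: measurableI => //.
  by case: ifP => // _; exact: measurable_set1.
apply/seteqP; split=> s /=.
  move=> [s0 sT]; split => //; split; first by rewrite in_itv/= s0.
  by case: ifP => //= bi; exact: sT.
move=> [_ []]; rewrite in_itv/= andbT => s0 sT; split => // bi.
by move: sT; rewrite bi.
Qed.

(** Only differences of [phi] enter the generator. A bounded [phi] can thus be made nonnegative,
    which sums in the extended reals require. *)
Lemma LK_shift (Vb : finType) (R : realType) (bnd : pred Vb) (E : {set Vb * Vb})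
    (T : Vb -> R) (phi : kstate Vb -> R) (c : R) :
  LK bnd E T (fun k => phi k + c) = LK bnd E T phi.
Proof.
have sh (x y : R) : (x + c) - (y + c) = x - y by ring.
apply/funext => k; apply: eq_bigr => e _; congr (_ * _).
apply: eq_bigr => h _; case: ifP => _; first exact: sh.
congr (limn _); apply/funext => n; apply: eq_bigr => b _.
by rewrite sh.
Qed.

Lemma integrable_counting (Vb : finType) (R : realType) (g : kstate Vb -> R) :
  (forall k, 0 <= g k) -> (\esum_(k in setT) (g k)%:E < +oo)%E ->
  (@counting (kstate Vb) R).-integrable setT (EFin \o g).
Proof.
move=> g0 goo; apply/integrableP; split => //.
under eq_integral do rewrite /comp gee0_abs ?lee_fin//.
by rewrite integral_counting_esum// => k; rewrite lee_fin.
Qed.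

(** * Intertwining of the generators on bounded nonnegative functions *)

Section bounded_observable.
Variables (Vb : finType) (R : realType) (bnd : pred Vb) (E : {set Vb * Vb}).
Variables (T : Vb -> R) (phi : kstate Vb -> R) (M : R).
Hypotheses (okE : graph_ok bnd E) (T0 : forall j, bnd j -> 0 < T j).
Hypotheses (phi0 : forall k, 0 <= phi k) (phiM : forall k, phi k <= M).

Let M0 : 0 <= M. Proof. exact: le_trans (phi0 [ffun=> 0%N]) (phiM _). Qed.

Lemma mixture_ge0 (psi : kstate Vb -> R) s :
  (forall k, 0 <= psi k) -> (forall i, 0 <= s i) -> (0 <= mixture psi s)%E.
Proof.
move=> psi0 s0; apply: esum_ge0 => k _.
by rewrite lee_fin mulr_ge0// geom_weight_ge0.
Qed.

Lemma mixture_le (s : Vb -> R) : (forall i, 0 <= s i) -> (mixture phi s <= M%:E)%E.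
Proof.
move=> s0; apply: (@le_trans _ _ (\esum_(k in setT) (M%:E * (geom_weight s k)%:E)%E)).
  by apply: le_esum => k _; rewrite -EFinM lee_fin ler_wpM2r// geom_weight_ge0.
by rewrite esumZl ?esum_geom_weight ?mule1// => k; rewrite lee_fin geom_weight_ge0.
Qed.

Lemma mixture_fin_num (s : Vb -> R) :
  (forall i, 0 <= s i) -> mixture phi s \is a fin_num.
Proof.
move=> s0; rewrite ge0_fin_numE; last exact: mixture_ge0.
by rewrite (le_lt_trans (mixture_le s0))// ltry.
Qed.

(* The negative part is discarded so that the observable is bounded on all states,
   not just on the support of the invariant measure. *)
Definition observable (s : ostate Vb R) : R :=
  fine (mixture phi (fun i => Num.max (s i) 0)).

Let max_ge0 (s : Vb -> R) i : 0 <= Num.max (s i) 0.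
Proof. by rewrite le_max lexx orbT. Qed.

Lemma EFin_observable (s : Vb -> R) :
  (forall i, 0 <= s i) -> (observable s)%:E = mixture phi s.
Proof.
move=> s0; rewrite /observable fineK ?mixture_fin_num//.
by congr mixture; apply/funext => i; rewrite max_l.
Qed.

Lemma observable_bounded (s : ostate Vb R) : `|observable s| <= M.
Proof.
rewrite ger0_norm; first by rewrite -lee_fin fineK ?mixture_fin_num// mixture_le.
by apply: fine_ge0; exact: mixture_ge0.
Qed.

Lemma measurable_observable : measurable_fun setT observable.
Proof.
apply: (measurableT_comp (f := fine)) => //.
apply: measurable_esum => [k|k s _].
  apply/measurable_EFinP; apply: measurable_funM => //.
  apply: measurable_prod => i _; rewrite -/(geom _ _).
  apply: measurable_geom_max; exact: measurable_coord.
by rewrite lee_fin mulr_ge0// geom_weight_ge0.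
Qed.

Let S := [set s : Vb -> R | forall i, 0 <= s i /\ (bnd i -> s i = T i)].

Lemma edge_kernel_ge0 e k : 0 <= edge_kernel bnd T phi e k.
Proof.
apply: split_avg_ge0 => l; case: ifPn => // /negbNE be.
by apply: (@resample_ge0 _ _ _ _ _ M) => //; exact/ltW/T0.
Qed.

(** On an internal edge [HO] with [bnd] and with [xpred0] agree. On a boundary edge, resampling
    resets the mixed mean at [e.2] to [T e.2], which on the support is [s e.2], the value that [HO]
    leaves there. *)
Lemma mixture_edge_kernel e s : e \in E -> S s ->
  mixture (edge_kernel bnd T phi e) s =
  (\int[@lebesgue_measure R]_(v in `[0%R, 1%R]) (observable (HO bnd e v s))%:E)%E.
Proof.
move=> eE Ss; have s0 i : 0 <= s i by have [] := Ss i.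
have [bE [neE _]] := okE; have e12 := neE _ eE; have b1 := bE _ eE.
have p0 k : 0 <= (if ~~ bnd e.2 then phi else resample e.2 (T e.2) phi) k.
  case: ifPn => // /negbNE be.
  by apply: (@resample_ge0 _ _ _ _ _ M) => //; exact/ltW/T0.
rewrite /mixture /edge_kernel esum_split_avg_HO//.
apply: eq_integral => v /set_mem v01; rewrite EFin_observable; last exact: HO_ge0.
case: ifPn => [b2|/negbNE b2].
  apply: eq_esum => k _; congr (_ * geom_weight _ _)%:E; apply/funext => l.
  rewrite /HO /= andbT; case: (eqVneq l e.1) => [->|_] /=; first by rewrite b1.
  by case: (eqVneq l e.2) => [->|_] //=; rewrite b2.
rewrite (@esum_resample _ _ _ _ _ M)//; last 2 first.
- exact/ltW/T0.
- exact: HO_ge0.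
apply: eq_esum => k _; congr (_ * geom_weight _ _)%:E; apply/funext => l.
rewrite /upd /HO /=; case: (eqVneq l e.2) => [->|_].
  by rewrite b2 andbF; have [_ ->] := Ss e.2.
by rewrite orbF andbT; case: (eqVneq l e.1) => [->|_] //=; rewrite b1.
Qed.

(** The subtracted [phi k] comes out of both averages: the uniform one has N + 1 equal terms, and
    the geometric masses sum to 1. *)
Lemma LKE k : LK bnd E T phi k =
  \sum_(e in E) (edge_kernel bnd T phi e k - phi k).
Proof.
apply: eq_bigr => e _; rewrite /edge_kernel /split_avg.
set N := (k e.1 + k e.2)%N.
have Nn0 : (N + 1)%:R != 0 :> R by rewrite pnatr_eq0 addn1.
have sumc : \sum_(0 <= h < N.+1) phi k = (N + 1)%:R * phi k.
  by rewrite big_const_nat subn0 iter_addr_0 mulr_natl addn1.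
rewrite -[X in _ = _ - X](mulKf Nn0) -sumc -mulrBr -sumrB.
congr (_ * _); apply: eq_bigr => h _; case: ifPn => // /negbNE be.
have t0 : 0 <= T e.2 by exact/ltW/T0.
apply/cvg_lim => //.
under eq_fun do under eq_bigr do rewrite HKb_kupd mulrBr.
under eq_fun do rewrite sumrB -mulr_suml.
apply: cvgB; first exact: (@is_cvg_resample _ _ _ _ _ M).
have /cvgM/(_ (cvg_cst (phi k))) := cvg_geom t0.
by rewrite mul1r.
Qed.

Lemma integrable_observable_HO e (s : Vb -> R) : (forall i, 0 <= s i) ->
  (@lebesgue_measure R).-integrable `[0%R, 1%R]
    (EFin \o (fun v => observable (HO bnd e v s))).
Proof.
move=> s0; apply: measurable_bounded_integrable => //.
- by rewrite /= lebesgue_measure_itv /= lte_fin ltr01 -EFinB ltry.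
(* Measurability in [v] is obtained term by term from the series of the mixture. *)
- apply: (@eq_measurable_fun _ _ _ _ _ (fun v => fine (mixture phi (HO bnd e v s)))).
    by move=> v /set_mem v01; rewrite -EFin_observable//; exact: HO_ge0.
  apply: (measurableT_comp (f := fine)) => //.
  apply: measurable_esum => [k|k v v01].
    apply/measurable_EFinP; apply: measurable_funM => //.
    exact: measurable_geom_weight_HO.
  by rewrite lee_fin mulr_ge0// geom_weight_ge0//; exact: HO_ge0.
- exists M; split; rewrite ?num_real// => x Mx v _ /=.
  by rewrite (le_trans (observable_bounded _))// ltW.
Qed.

(** Finiteness follows from [mixture_edge_kernel]: the sum is the integral of a bounded function
    over [0, 1]. *)
Lemma integrable_edge_kernel e s : e \in E -> S s ->
  (@counting (kstate Vb) R).-integrable setT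
    (EFin \o (fun k => edge_kernel bnd T phi e k * geom_weight s k)).
Proof.
move=> eE Ss; have s0 i : 0 <= s i by have [] := Ss i.
apply: integrable_counting.
  by move=> k; rewrite mulr_ge0 ?edge_kernel_ge0 ?geom_weight_ge0.
rewrite -/(mixture _ _) mixture_edge_kernel// ltey_eq.
by rewrite (integrable_fin_num _ (integrable_observable_HO e s0)).
Qed.

Lemma integral_LK_geom_weight s : S s ->
  (\int[@counting (kstate Vb) R]_k (LK bnd E T phi k * geom_weight s k)%:E)%E =
  (LO bnd E observable s)%:E.
Proof.
move=> Ss; have s0 i : 0 <= s i by have [] := Ss i.
have iphi : (@counting (kstate Vb) R).-integrable setT
    (EFin \o (fun k => phi k * geom_weight s k)).
  apply: integrable_counting.
    by move=> k; rewrite mulr_ge0 ?geom_weight_ge0.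
  by rewrite -/(mixture _ _) (le_lt_trans (mixture_le s0))// ltry.
(* The value 0 off [E] makes every [g e] integrable, so that integral and sum can be exchanged. *)
pose g e : kstate Vb -> R := if e \in E then
  fun k => edge_kernel bnd T phi e k * geom_weight s k - phi k * geom_weight s k
  else cst 0.
have ig e : (@counting (kstate Vb) R).-integrable setT (EFin \o g e).
  rewrite /g; case: ifPn => eE; last exact: integrable0.
  exact: (integrableB _ (integrable_edge_kernel eE Ss) iphi).
transitivity (\int[@counting (kstate Vb) R]_k \sum_(e in E) (g e k)%:E)%E.
  apply: eq_integral => k _; rewrite LKE mulr_suml -sumEFin.
  by apply: eq_bigr => e eE; rewrite /g eE mulrBl.
rewrite integral_sum// /LO -sumEFin; apply: eq_bigr => e eE.
transitivity ((\int[@counting (kstate Vb) R]_k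
    ((edge_kernel bnd T phi e k * geom_weight s k)%:E - (phi k * geom_weight s k)%:E)))%E.
  by apply: eq_integral => k _; rewrite /g eE.
rewrite integralB_EFin//; last exact: integrable_edge_kernel.
rewrite !integral_counting_esum; last 2 first.
- by move=> k; rewrite lee_fin mulr_ge0 ?geom_weight_ge0.
- by move=> k; rewrite lee_fin mulr_ge0 ?edge_kernel_ge0 ?geom_weight_ge0.
rewrite -!/(mixture _ _) mixture_edge_kernel// -(EFin_observable s0).
have iO := integrable_observable_HO e s0.
rewrite RintegralB//; last first.
  apply: measurable_bounded_integrable => //.
  - by rewrite /= lebesgue_measure_itv /= lte_fin ltr01 -EFinB ltry.
  - exact: bounded_cst.
rewrite Rintegral_cst//= lebesgue_measure_itv /= lte_fin ltr01 /= oppr0 addr0 mulr1.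
by rewrite EFinB /Rintegral fineK// integrable_fin_num.
Qed.

End bounded_observable.

Theorem theorem5p1 (R : realType) (Vb : finType) (bnd : pred Vb)
    (E : {set Vb * Vb}) (T : Vb -> R)
    (nu : probability (ostate Vb R) R) :
  graph_ok bnd E ->
  (forall j, bnd j -> 0 < T j) ->
  O_supported bnd T nu ->
  O_invariant bnd E nu ->
  K_invariant_muK bnd E T nu.
Proof.
move=> okE T0 nuS nu_inv phi [M phiM].
(* Adding the bound [M] places the test function between 0 and 2M. *)
rewrite -(LK_shift bnd E T phi M) /muK_int.
set phi' := fun k => phi k + M.
have phi'0 k : 0 <= phi' k.
  by have := phiM k; rewrite ler_norml => /andP[]; rewrite /phi'; lra.
have phi'M k : phi' k <= M + M.
  by have := phiM k; rewrite ler_norml => /andP[]; rewrite /phi'; lra.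
have mS := measurable_support bnd T.
have nS0 : nu (~` [set s : ostate Vb R |
    forall i, 0 <= s i /\ (bnd i -> s i = T i)]) = 0%E.
  by rewrite probability_setC// nuS subee.
(* The intertwining holds only on the support of [nu], whose complement is null; this suffices to
   replace the integrand. *)
rewrite (@eq_integral_full _ _ _ _ _ _
    (fun s : ostate Vb R => (LO bnd E (observable phi') s)%:E) mS nS0).
- apply: nu_inv; first exact: (measurable_observable phi'0).
  by exists (M + M) => s; exact: (observable_bounded phi'0 phi'M).
- by move=> s Ss; exact: (integral_LK_geom_weight okE T0 phi'0 phi'M).
Qed.
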